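(* Let $(T_n)_{n\in\mathbb{Z}}$ be the Tribonacci sequence extended to all integers: $T_0=0$, $T_1=1$, $T_2=1$ and $T_n=T_{n-1}+T_{n-2}+T_{n-3}$ for all integers $n$. Then for every integer $n\ge 1$: (a) $\sum_{k=1}^{n}T_{-k}=\frac{1}{2}(-3T_{-n-1}-2T_{-n-2}-T_{-n-3}+1).$ (b) $\sum_{k=1}^{n}T_{-2k}=\frac{1}{2}(-T_{-2n+1}+T_{-2n}+1).$ (c) $\sum_{k=1}^{n}T_{-2k+1}=\frac{1}{2}(-T_{-2n}-T_{-2n-1}).$ *)

(* Defs.v *)
From mathcomp Require Import all_boot all_order all_algebra.
From mathcomp Require Import ring.

Set Implicit Arguments.
Unset Strict Implicit.
Unset Printing Implicit Defensive.

Import GRing.Theory.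
Local Open Scope ring_scope.

(* The recurrence at every integer index determines the values at negative
   indices too, so these conditions characterize one two-sided sequence. *)
Definition is_tribonacci (T : int -> int) : Prop :=
  [/\ T 0 = 0, T 1 = 1, T 2 = 1
    & forall n : int, T n = T (n - 1) + T (n - 2) + T (n - 3)].

Definition trib_fwd (t : int * int * int) : int * int * int :=
  let: (a, b, c) := t in (b, c, a + b + c).

Definition trib_bwd (t : int * int * int) : int * int * int :=
  let: (a, b, c) := t in (c - a - b, a, b).

(* trib_window n is (T n, T (n + 1), T (n + 2)). *)
Definition trib_window (n : int) : int * int * int :=
  match n with
  | Posz m => iter m trib_fwd (0, 1, 1)
  | Negz m => iter m.+1 trib_bwd (0, 1, 1)
  end.

Definition tribonacci (n : int) : int := (trib_window n).1.1.

Lemma trib_bwdK : cancel trib_bwd trib_fwd.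
Proof. by case=> [[a b] c] /=; congr (_, _, _); ring. Qed.

Lemma trib_windowS (n : int) : trib_window (n + 1) = trib_fwd (trib_window n).
Proof.
case: n => [m|[|m]].
- by rewrite -PoszD addn1.
- by [].
- have -> : Negz m.+1 + 1 = Negz m by rewrite !NegzE -(addn1 m.+1) PoszD; ring.
  by rewrite /trib_window iterS trib_bwdK.
Qed.

Lemma tribonacciP : is_tribonacci tribonacci.
Proof.
split=> // n; rewrite /tribonacci.
have -> : n = n - 3 + 1 + 1 + 1 by ring.
have -> : n - 3 + 1 + 1 + 1 - 1 = n - 3 + 1 + 1 by ring.
have -> : n - 3 + 1 + 1 + 1 - 2 = n - 3 + 1 by ring.
have -> : n - 3 + 1 + 1 + 1 - 3 = n - 3 by ring.
rewrite !trib_windowS; case: (trib_window (n - 3)) => [[a b] c] /=; ring.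
Qed.

Lemma tribonacci_uniq (T : int -> int) : is_tribonacci T -> T =1 tribonacci.
Proof.
move=> [T0 T1 T2 Trec].
have [U0 U1 U2 Urec] := tribonacciP.
have fwd (m : nat) : [/\ T m%:Z = tribonacci m%:Z,
    T (m%:Z + 1) = tribonacci (m%:Z + 1) & T (m%:Z + 2) = tribonacci (m%:Z + 2)].
  elim: m => [|m [e0 e1 e2]]; first by rewrite !add0r T0 T1 T2.
  have s1 : m.+1%:Z = m%:Z + 1 by rewrite -addn1 PoszD.
  have s2 : m%:Z + 1 + 1 = m%:Z + 2 by ring.
  rewrite s1 s2; split=> //; rewrite Trec Urec.
  have -> : m%:Z + 1 + 2 - 1 = m%:Z + 2 by ring.
  have -> : m%:Z + 1 + 2 - 2 = m%:Z + 1 by ring.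
  have -> : m%:Z + 1 + 2 - 3 = m%:Z by ring.
  by rewrite e0 e1 e2.
have bwd (m : nat) : [/\ T (- m%:Z) = tribonacci (- m%:Z),
    T (- m%:Z + 1) = tribonacci (- m%:Z + 1)
    & T (- m%:Z + 2) = tribonacci (- m%:Z + 2)].
  elim: m => [|m [e0 e1 e2]]; first by rewrite oppr0 !add0r T0 T1 T2.
  have s0 : - m.+1%:Z = - m%:Z - 1 by rewrite -addn1 PoszD; ring.
  have s1 : - m%:Z - 1 + 1 = - m%:Z by ring.
  have s2 : - m%:Z - 1 + 2 = - m%:Z + 1 by ring.
  rewrite s0 s1 s2; split=> //.
  have := Trec (- m%:Z + 2); have := Urec (- m%:Z + 2).
  have -> : - m%:Z + 2 - 1 = - m%:Z + 1 by ring.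
  have -> : - m%:Z + 2 - 2 = - m%:Z by ring.
  have -> : - m%:Z + 2 - 3 = - m%:Z - 1 by ring.
  by rewrite e0 e1 e2 => -> /addrI.
case=> m; first by case: (fwd m).
by rewrite NegzE; case: (bwd m.+1).
Qed.

(* Main.v *)
(* Each closed form vanishes at n = 0 and its successive differences are twice
   the summand, by a single use of the recurrence. *)
Require Import Defs.
From mathcomp Require Import all_boot all_order all_algebra.
From mathcomp Require Import ring.

Set Implicit Arguments.
Unset Strict Implicit.
Unset Printing Implicit Defensive.

Import GRing.Theory.
Local Open Scope ring_scope.

(** Twice each sum telescopes: with [g] the bracket on the right, [half_telescope] reduces the claim
    to a starting value and an increment. The start needs T at -1, -2, -3, found by running the
    recurrence backwards. Each increment is a combination of four consecutive terms T(m), ...,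
    T(m-3), and the one relation among them collapses it to twice a single term. *)

Lemma half_telescope (f g : nat -> int) (n : nat) :
    g 0%N = 0 -> (forall k, g k.+1 - g k = 2 * f k.+1) ->
  (\sum_(1 <= k < n.+1) f k)%:~R = 1 / 2 * (g n)%:~R :> rat.
Proof.
move=> g0 gS.
(* The doubled identity holds over the integers; only the final halving takes place in [rat]. *)
have <- : 2 * (\sum_(1 <= k < n.+1) f k) = g n.
  rewrite big_add1 /= mulr_sumr -[RHS]subr0 -[X in _ = _ - X]g0 -telescope_sumr //.
  by apply: eq_bigr => k _; rewrite gS.
by rewrite intrM; field.
Qed.

Theorem corollary3p3 (T : int -> int) (hT : is_tribonacci T)
    (n : nat) (hn : (1 <= n)%N) :
  [/\ (\sum_(1 <= k < n.+1) T (- k%:Z))%:~R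
        = 1 / 2 * (- 3 * T (- n%:Z - 1) - 2 * T (- n%:Z - 2)
                   - T (- n%:Z - 3) + 1)%:~R :> rat,
      (\sum_(1 <= k < n.+1) T (- (2 * k%:Z)))%:~R
        = 1 / 2 * (- T (- (2 * n%:Z) + 1) + T (- (2 * n%:Z)) + 1)%:~R :> rat
    & (\sum_(1 <= k < n.+1) T (- (2 * k%:Z) + 1))%:~R
        = 1 / 2 * (- T (- (2 * n%:Z)) - T (- (2 * n%:Z) - 1))%:~R :> rat].
Proof.
have [T0 T1 T2 Trec] := hT.
(* The recurrence solved for its lowest index, the direction in which these sums run. *)
have Tback m : T (m - 3) = T m - T (m - 1) - T (m - 2).
  by rewrite [T m]Trec; ring.
have TN1 : T (- 1) = 0 by rewrite (Tback 2) T2 T1 T0.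
have TN2 : T (- 2) = 1 by rewrite (Tback 1) T1 T0 TN1.
have TN3 : T (- 3) = - 1 by rewrite (Tback 0) T0 TN1 TN2.
split.
- apply: (half_telescope (f := fun k => T (- k%:Z))
    (g := fun k => - 3 * T (- k%:Z - 1) - 2 * T (- k%:Z - 2)
                   - T (- k%:Z - 3) + 1)) => [|k].
    by rewrite oppr0 !add0r TN1 TN2 TN3.
  have -> : - k.+1%:Z = - k%:Z - 1 by rewrite intS; ring.
  (* The increment is 3T(m) - T(m-1) - T(m-2) - T(m-3), which is 2T(m). *)
  set m := - k%:Z - 1.
  have -> : - k%:Z - 2 = m - 1 by rewrite /m; ring.
  have -> : - k%:Z - 3 = m - 2 by rewrite /m; ring.
  by rewrite Tback; ring.
- apply: (half_telescope (f := fun k => T (- (2 * k%:Z)))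
    (g := fun k => - T (- (2 * k%:Z) + 1) + T (- (2 * k%:Z)) + 1)) => [|k].
    by rewrite mulr0 oppr0 add0r T0 T1.
  (* Here the increment T(m) - T(m-1) - T(m-2) + T(m-3) is 2T(m-3). *)
  set m := - (2 * k%:Z) + 1.
  have -> : - (2 * k.+1%:Z) + 1 = m - 2 by rewrite /m intS; ring.
  have -> : - (2 * k.+1%:Z) = m - 3 by rewrite /m intS; ring.
  have -> : - (2 * k%:Z) = m - 1 by rewrite /m; ring.
  by rewrite Tback; ring.
- apply: (half_telescope (f := fun k => T (- (2 * k%:Z) + 1))
    (g := fun k => - T (- (2 * k%:Z)) - T (- (2 * k%:Z) - 1))) => [|k].
    by rewrite mulr0 oppr0 add0r T0 TN1.
  (* Here the increment T(m) + T(m-1) - T(m-2) - T(m-3) is 2T(m-1). *)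
  set m := - (2 * k%:Z).
  have -> : - (2 * k.+1%:Z) + 1 = m - 1 by rewrite /m intS; ring.
  have -> : - (2 * k.+1%:Z) - 1 = m - 3 by rewrite /m intS; ring.
  have -> : - (2 * k.+1%:Z) = m - 2 by rewrite /m intS; ring.
  by rewrite Tback; ring.
Qed.
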